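(* Let $C_n$ be the number of cycles of a permutation chosen uniformly at random from the permutations of $[2n]$ with all cycle lengths even. Then, as $n\to\infty$, $C_n$ is asymptotically normally distributed, with \[ \mathbb{E}(C_n)=\frac12\log n+\left(\frac12\gamma+\log2\right)+O(n^{-1}) \] and \[ \mathbb{V}(C_n)=\frac12\log n+\left(\frac12\gamma+\log2-\frac{\pi^2}{8}\right)+O(n^{-1}). \]
   Context: $\gamma$ denotes the Euler–Mascheroni constant. Asymptotic normality means $(C_n-\mathbb{E}C_n)/\sqrt{\mathbb{V}C_n}$ converges in distribution to a standard normal. *)

(* Defs.v *)
From HB Require Import structures.
From mathcomp Require Import all_boot all_order all_algebra all_fingroup.
From mathcomp Require Import all_classical all_reals all_analysis.
Set Implicit Arguments. Unset Strict Implicit. Unset Printing Implicit Defensive.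
Import Order.TTheory GRing.Theory Num.Theory numFieldNormedType.Exports.
Local Open Scope classical_set_scope.
Local Open Scope ring_scope.

Definition all_cycles_even (m : nat) (s : 'S_m) : bool :=
  [forall c in porbits s, ~~ odd #|c|].

Definition EvenPerms (n : nat) : {set 'S_(2 * n)} :=
  [set s : 'S_(2 * n) | all_cycles_even s].

Definition ncycles (m : nat) (s : 'S_m) : nat := #|porbits s|.

Definition meanC (R : realType) (n : nat) : R :=
  (\sum_(s in EvenPerms n) (ncycles s)%:R) / (#|EvenPerms n|)%:R.

Definition varC (R : realType) (n : nat) : R :=
  (\sum_(s in EvenPerms n) ((ncycles s)%:R - meanC R n) ^+ 2)
    / (#|EvenPerms n|)%:R.

(* Distribution function of the standardized variable (C_n - E C_n)/sqrt(V C_n):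
   P((C_n - E C_n)/sqrt(V C_n) <= x) = P(C_n <= E C_n + x sqrt(V C_n)). *)
Definition cdf_std_C (R : realType) (n : nat) (x : R) : R :=
  (#|[set s in EvenPerms n |
       (ncycles s)%:R <= meanC R n + x * Num.sqrt (varC R n)]|)%:R
    / (#|EvenPerms n|)%:R.

Definition std_normal_cdf (R : realType) (x : R) : R :=
  Rintegral (@lebesgue_measure R) `]-oo, x]
    (fun t : R => expR (- (t ^+ 2) / 2) / Num.sqrt (2 * pi)).

Definition euler_gamma (R : realType) : R :=
  lim ((fun n : nat => \sum_(k < n) (k.+1%:R : R)^-1 - ln (n%:R : R)) @ \oo).

Arguments meanC R n : clear implicits.
Arguments varC R n : clear implicits.
Arguments cdf_std_C R n x : clear implicits.
Arguments std_normal_cdf R x : clear implicits.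
Arguments euler_gamma R : clear implicits.

(* Main.v *)
(* Removing a fixed point a together with its image b = s a from a permutation s
   of 2n + 2 points with all cycles even leaves such a permutation of 2n points.
   For each of the 2n + 1 choices of b there are 2n + 1 ways back, one per image q
   of b: q = a creates the cycle (a b), and the other 2n choices leave the number of
   cycles unchanged.
   Hence C_n is distributed as a sum of independent Bernoulli variables of
   parameters 1/(2k+1), k < n, so that
     E C_n = H_{2n} - H_n / 2  and  V C_n = E C_n - sum_{k < n} 1/(2k+1)^2.
   The inverse odd squares are summed by the identity
     sum_{k < 2^m} csc^2 ((2k+1) pi / 2^(m+2)) = 2 * 4^m,
   which follows by induction from csc^2 x + sec^2 x = 4 csc^2 (2x), and
   cot^2 x <= 1/x^2 <= csc^2 x.

   Asymptotic normality is Lindeberg's replacement argument. With Phi the normal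
   distribution function, U(v, x) = Phi (x / sqrt v) solves the heat equation
   U_v = U_xx / 2; so exchanging a centered Bernoulli step of parameter p for an
   increase of v by p(1 - p) costs O(p (v^(-3/2) + v^(-2))). Summed over the steps,
   starting from v = t^2 V C_n, this is O_t((V C_n)^(-1/2)), and Phi (x / t) is a
   smoothed indicator of the half line as t -> 0. *)
Require Import Defs.
From HB Require Import structures.
From mathcomp Require Import all_boot all_order all_algebra all_fingroup.
From mathcomp Require Import all_classical all_reals all_analysis.
From mathcomp Require Import ring lra zify.
Import Order.TTheory GRing.Theory Num.Theory numFieldNormedType.Exports.
Set Implicit Arguments.
Unset Strict Implicit.
Unset Printing Implicit Defensive.
Local Open Scope classical_set_scope.
Local Open Scope ring_scope.

(** * Splicing two points into a permutation with even cycles *)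

(** Supports vary inside one fixed type, so removing two points does not change the type; points
    outside [S] remain as singleton orbits. *)
Definition even_perms_on (T : finType) (S : {set T}) : {set {perm T}} :=
  [set s | perm_on S s && [forall x in S, ~~ odd #|porbit s x|]].

(** A cycle is even exactly when two colours can alternate along it. Unlike orbit lengths, a
    colouring needs only local changes when points are inserted or removed. *)
Lemma even_porbitsP (T : finType) (S : {set T}) (s : {perm T}) :
  perm_on S s ->
  reflect (exists f : T -> bool, {in S, forall x, f (s x) = ~~ f x})
          [forall x in S, ~~ odd #|porbit s x|].
Proof.
move=> sS; apply: (iffP forall_inP) => [ev|[f fs] x xS]; last first.
  have iterf k : iter k s x \in S /\ f (iter k s x) = odd k (+) f x.
    elim: k => //= k [kS fk]; rewrite perm_closed// fs// fk; split=> //.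
    by rewrite addNb.
  have [_] := iterf #|porbit s x|; rewrite iter_porbit.
  by case: (odd _) (f x) => - [].
(* The choice depends only on the orbit, so [r] is a representative common to a whole cycle; colours
   are parities of positions counted from it. *)
pose r x := if [pick y in porbit s x] is Some y then y else x.
have rP x : r x \in porbit s x.
  rewrite /r; case: pickP => // /(_ x).
  by rewrite porbit_id.
have porbit_s x : porbit s (s x) = porbit s x.
  by rewrite -[s x](permX s x 1) porbit_perm.
have r_s x : r (s x) = r x.
  rewrite /r porbit_s; case: pickP => // /(_ x).
  by rewrite porbit_id.
exists (fun x => odd (index x (traject s (r x) #|porbit s (r x)|))) => x xS.
rewrite r_s; set N := #|_|; set tr := traject _ _ _.
have porbit_r : porbit s (r x) = porbit s x by apply/eqP; rewrite eq_porbit_mem.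
have evN : ~~ odd N by rewrite /N porbit_r ev.
have utr : uniq tr by exact: uniq_traject_porbit.
have szt : size tr = N by rewrite size_traject.
have xtr : x \in tr by rewrite -porbit_traject porbit_r porbit_id.
set i := index x tr.
have ltiN : (i < N)%N by rewrite -szt index_mem.
have xE : x = iter i s (r x) by rewrite -(nth_traject s ltiN) nth_index.
have sxE : s x = iter i.+1 s (r x) by rewrite {1}xE.
have [ltSiN|leNSi] := ltnP i.+1 N.
  by rewrite sxE -(nth_traject s ltSiN) index_uniq ?szt.
(* The wrap-around: the last position [N - 1] is odd, and position 0 follows it. *)
have NE : N = i.+1 by apply/eqP; rewrite eqn_leq leNSi ltiN.
have sxr : s x = r x by rewrite sxE -NE iter_porbit.
rewrite sxr.
have -> : index (r x) tr = 0%N by rewrite /tr NE /= eqxx.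
by move: evN; rewrite NE /= negbK => ->.
Qed.

Lemma mem_porbit_fixed (T : finType) (u : {perm T}) (a b : T) :
  u b = b -> (a \in porbit u b) = (a == b).
Proof.
move=> ub; apply/idP/eqP => [/porbitP[i ->]|->]; last exact: porbit_id.
exact: permX_fix.
Qed.

(* Splices the points a and b into a permutation s fixing both, so that the
   result maps a to b and b to q; for q = a it creates the 2-cycle (a b). *)
Definition splice2 (T : finType) (a b q : T) (s : {perm T}) : {perm T} :=
  (tperm a b * s * tperm a q)%g.

Lemma splice2K (T : finType) (a b q : T) : involutive (splice2 a b q).
Proof.
move=> s; rewrite /splice2 -!mulgA tperm2 mulg1 !mulgA tperm2.
by rewrite mul1g.
Qed.

(** The right factor joins the fixed point [a] to the cycle of [q] unless [q = a]; the left factor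
    then joins the fixed point [b] to the cycle of [a]. Each junction costs one orbit. *)
Lemma card_porbits_splice2 (T : finType) (a b q : T) (s : {perm T}) :
  a != b -> q != b -> s a = a -> s b = b ->
  (#|porbits (splice2 a b q s)| + 1 + (q != a) = #|porbits s|)%N.
Proof.
move=> ab qb sa sb; rewrite /splice2 -mulgA; set u := (s * tperm a q)%g.
have ub : u b = b by rewrite /u permM sb tpermD.
have uE : (#|porbits u| + (q != a) = #|porbits s|)%N.
  (* Inverting moves the transposition to the left, where [porbits_mul_tperm] applies. *)
  rewrite -porbitsV /u invMg tpermV -(porbitsV s).
  have sVa : s^-1%g a = a by rewrite -{1}sa permK.
  have := porbits_mul_tperm (s^-1)%g q a; rewrite tpermC /=.
  rewrite (mem_porbit_fixed _ sVa); case: (eqVneq q a) => [->|_] /=.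
    by rewrite !addn0.
  by rewrite -[(1.*2)%N]/(1 + 1)%N addnA => /addIn.
have := porbits_mul_tperm u a b; rewrite /= (mem_porbit_fixed _ ub) ab /=.
by rewrite -uE -[(1.*2)%N]/(1 + 1)%N addnA => /addIn ->.
Qed.

(** A colouring of the larger permutation restricts to the smaller one: [q] comes two steps after
    [a], so bypassing [a] and [b] preserves alternation. Conversely a colouring extends to [a] and
    [b]. *)
Lemma splice2_even_perms_on (T : finType) (S : {set T}) (a b q : T)
    (s : {perm T}) :
  a \in S -> b \in S -> q \in S -> a != b -> q != b ->
  (splice2 a b q s \in even_perms_on S) && (splice2 a b q s a == b)
    && (splice2 a b q s b == q) = (s \in even_perms_on (S :\ a :\ b)).
Proof.
move=> aS bS qS ab qb; have ba : b != a by rewrite eq_sym.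
have bq : b != q by rewrite eq_sym.
rewrite !inE; apply/idP/idP.
  set t := splice2 a b q s => /andP[/andP[/andP[tS tev] /eqP ta] /eqP tb].
  have sE : s = splice2 a b q t by rewrite /t splice2K.
  have sx x : s x = tperm a q (t (tperm a b x)) by rewrite sE /splice2 !permM.
  have sa : s a = a by rewrite sx tpermL tb tpermR.
  have sb : s b = b by rewrite sx tpermR ta tpermD // eq_sym.
  have sS : perm_on (S :\ a :\ b) s.
    apply/fintype.subsetP => x; rewrite !inE => nx.
    have xa : x != a by apply: contraNneq nx => ->; rewrite sa.
    have xb : x != b by apply: contraNneq nx => ->; rewrite sb.
    rewrite xa xb /=; apply: contraNT nx => xS.
    rewrite sx [tperm a b x]tpermD 1?[_ == x]eq_sym // (out_perm tS xS) tpermD 1?eq_sym//.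
    by apply: contraNneq xS => ->.
  rewrite sS /=; apply/even_porbitsP => //.
  have /(even_porbitsP tS)[f fP] := tev.
  exists f => x; rewrite !inE => /and3P[xb xa xS].
  rewrite sx [tperm a b x]tpermD 1?[_ == x]eq_sym//.
  case: tpermP => [txa|txq|_ _]; last exact: fP.
  - by rewrite -tb -ta !fP // ?ta// -txa fP // negbK.
  - by case/eqP: xb; apply: (@perm_inj _ t); rewrite tb.
move=> /andP[sS sev]; set t := splice2 a b q s.
have tx x : t x = tperm a q (s (tperm a b x)) by rewrite /t /splice2 !permM.
have sa : s a = a by rewrite (out_perm sS)// !inE eqxx andbF.
have sb : s b = b by rewrite (out_perm sS)// !inE eqxx.
have ta : t a = b by rewrite tx tpermL sb tpermD // eq_sym.
have tb : t b = q by rewrite tx tpermR sa tpermL.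
rewrite ta tb !eqxx !andbT.
have tS : perm_on S t.
  apply/fintype.subsetP => x; rewrite !inE; apply: contraNT => xS.
  rewrite tx [tperm a b x]tpermD; last 2 first.
  - by apply: contraNneq xS => <-.
  - by apply: contraNneq xS => <-.
  rewrite (out_perm sS) ?tpermD//.
  - by apply: contraNneq xS => <-.
  - by apply: contraNneq xS => <-.
  - by rewrite !inE (negPf xS) !andbF.
rewrite tS /=; apply/even_porbitsP => //.
have /(even_porbitsP sS)[f fP] := sev.
(* Along [a], [b], [q] the point [a] must get the colour of [q]; for [q = a] this is an arbitrary
   value. *)
exists (fun x => if x == a then f q else if x == b then ~~ f q else f x).
move=> x xS /=; have [->|xa] := eqVneq x a.
  by rewrite ta eqxx (negPf ba).
have [->|xb] := eqVneq x b.
  by rewrite tb (negPf qb) negbK; case: eqVneq => // ->.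
have xS' : x \in S :\ a :\ b by rewrite !inE xa xb.
have : s x \in S :\ a :\ b by rewrite perm_closed.
rewrite !inE => /and3P[sxb sxa sxS].
rewrite tx [tperm a b x]tpermD 1?[_ == x]eq_sym//.
case: tpermP => [sxE|<-|_ _].
- by rewrite sxE eqxx in sxa.
- by rewrite eqxx fP.
- by rewrite (negPf sxa) (negPf sxb) fP.
Qed.

(** * The recursion for sums over permutations with even cycles *)

(** The outer factor counts the images [b] of [a]; the shifted summand is the case [q = a], the
    other one the remaining [2 * m] images of [b]. *)
Fixpoint even_cycle_sum (V : nmodType) (n : nat) (g : nat -> V) : V :=
  if n is m.+1 then
    (even_cycle_sum m (fun k => g k.+1) + even_cycle_sum m g *+ (2 * m))
      *+ (2 * m).+1
  else g 0%N.

Lemma even_cycle_sumS (V : nmodType) (n : nat) (g : nat -> V) :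
  even_cycle_sum n.+1 g =
    (even_cycle_sum n (fun k => g k.+1) + even_cycle_sum n g *+ (2 * n))
      *+ (2 * n).+1.
Proof. by []. Qed.

Lemma eq_even_cycle_sum (V : nmodType) (n : nat) (g h : nat -> V) :
  g =1 h -> even_cycle_sum n g = even_cycle_sum n h.
Proof.
elim: n g h => [|n IHn] g h gh /=; first exact: gh.
by rewrite (IHn _ _ gh) (IHn _ (fun k => h k.+1)).
Qed.

Lemma sum_even_perms_on (V : nmodType) (T : finType) (n : nat) (g : nat -> V)
    (S : {set T}) : #|S| = (2 * n)%N ->
  \sum_(s in even_perms_on S) g #|porbits s|
    = even_cycle_sum n (fun k => g (k + #|~: S|)%N).
Proof.
elim: n g S => [|n IHn] g S cardS.
  have S0 : S = finset.set0 by apply/eqP; rewrite -cards_eq0 cardS.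
  rewrite S0 (_ : even_perms_on finset.set0 = [set 1%g])%SET; last first.
    apply/finset.setP => s; rewrite !inE; apply/andP/eqP => [[sS _]|->]; last first.
      by rewrite perm_on1; split=> //; apply/forall_inP => x; rewrite inE.
    by apply: (perm_on_id sS); rewrite cards0.
  rewrite big_set1 /= add0n; congr g.
  rewrite finset.setC0 /porbits card_imset ?cardsT // => x y /eqP.
  rewrite eq_porbit_mem mem_porbit_fixed ?perm1//.
  by move=> /eqP.
have [a aS] : exists a, a \in S.
  by apply/finset.set0Pn; rewrite -card_gt0 cardS.
rewrite (partition_big (fun s : {perm T} => s a) (mem (S :\ a)%SET)); last first.
  move=> s; rewrite !inE => /andP[sS /even_porbitsP[]// f fP].
  rewrite perm_closed // aS andbT; apply/eqP => sa.
  by have := fP a aS; rewrite sa; case: (f a).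
rewrite even_cycle_sumS.
have -> : (2 * n).+1 = #|(S :\ a)%SET|.
  by have := cardsD1 a S; rewrite aS cardS; lia.
rewrite -sumr_const; apply: eq_bigr => b; rewrite !inE => /andP[ba bS].
have ab : a != b by rewrite eq_sym.
rewrite (partition_big (fun s : {perm T} => s b) (mem (S :\ b)%SET)); last first.
  move=> s /andP[]; rewrite !inE => /andP[sS _] /eqP sab.
  rewrite perm_closed // bS andbT -{2}sab.
  by rewrite (inj_eq perm_inj).
have cardS' : #|S :\ a :\ b|%SET = (2 * n)%N.
  by have := cardsD1 a S; have := cardsD1 b (S :\ a)%SET;
     rewrite !inE aS bS ba cardS /=; lia.
have cardC : #|~: (S :\ a :\ b)|%SET = (#|~: S|%SET).+2.
  have := cardsC (S :\ a :\ b)%SET; have := cardsC S.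
  rewrite cardS' cardS; lia.
have splice q : q \in (S :\ b)%SET ->
    \sum_(s | ((s \in even_perms_on S) && (s a == b)) && (s b == q))
      g #|porbits s| =
    even_cycle_sum n (fun k => g (k + #|~: S| + (q == a))%N).
  rewrite !inE => /andP[qb qS].
  rewrite (reindex_onto (splice2 a b q) (splice2 a b q)); last first.
    by move=> s _; rewrite splice2K.
  under eq_bigl => s do rewrite splice2K eqxx andbT splice2_even_perms_on //.
  (* Here [a] and [b] are two singleton orbits of [s], so the truncated subtractions are exact. *)
  rewrite (eq_bigr (fun s => g (#|porbits s| - 1 - (q != a))%N)); last first.
    move=> s; rewrite inE => /andP[sS _].
    have out x : x \notin (S :\ a :\ b)%SET -> s x = x by exact: out_perm.
    rewrite -(card_porbits_splice2 ab qb (out a _) (out b _)) ?inE ?eqxx ?andbF//.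
    by rewrite -subnDA -addnA addnK.
  rewrite (IHn (fun k => g (k - 1 - (q != a))%N) _ cardS').
  by apply: eq_even_cycle_sum => k; rewrite cardC; congr g;
     case: eqVneq => _ /=; lia.
rewrite (eq_bigr _ splice) (bigD1 a) /=; last by rewrite !inE ab.
rewrite eqxx; congr (_ + _).
  by apply: eq_even_cycle_sum => k; congr g; lia.
rewrite (eq_bigr (fun=> even_cycle_sum n (fun k => g (k + #|~: S|)%N))).
  rewrite sumr_const; congr (_ *+ _).
  rewrite -cardS'; apply: eq_card => x.
  by rewrite unfold_in /= !inE -andbA [(x \in S) && _]andbC.
move=> q /andP[_ /negPf ->].
by apply: eq_even_cycle_sum => k; rewrite addn0.
Qed.

Lemma sum_EvenPerms (V : nmodType) (n : nat) (g : nat -> V) :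
  \sum_(s in EvenPerms n) g (ncycles s) = even_cycle_sum n g.
Proof.
have := @sum_even_perms_on V 'I_(2 * n) n g [set: _]%SET.
rewrite cardsT card_ord => /(_ erefl).
rewrite finset.setCT cards0.
rewrite (@eq_even_cycle_sum _ _ _ g); last by move=> k; rewrite addn0.
move=> <-; apply: eq_bigl => s; rewrite !inE /all_cycles_even.
have -> : perm_on [set: 'I_(2 * n)]%SET s by apply/fintype.subsetP => x; rewrite inE.
apply/forall_inP/forall_inP => [ev x _|ev c /imsetP[x _ ->]].
  by apply: ev; apply: imset_f.
by apply: ev; rewrite inE.
Qed.

(* Conditioning on the last of n independent Bernoulli variables of parameters
   1/(2k+1), k < n: the mean of g at their sum. *)
Fixpoint cycle_mean (R : realType) (n : nat) (g : nat -> R) : R :=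
  if n is m.+1 then
    (cycle_mean m (fun k => g k.+1) + (2 * m)%:R * cycle_mean m g)
      / (2 * m).+1%:R
  else g 0%N.

Arguments cycle_mean : simpl never.

Lemma cycle_meanS (R : realType) (n : nat) (g : nat -> R) :
  cycle_mean n.+1 g =
    (cycle_mean n (fun k => g k.+1) + (2 * n)%:R * cycle_mean n g)
      / (2 * n).+1%:R.
Proof. by []. Qed.

(** * Bernoulli representation, mean and variance of the cycle count *)

Section cycle_mean_theory.
Variable R : realType.
Implicit Types g h : nat -> R.

Lemma cycle_mean_lin n (a b : R) g h :
  cycle_mean n (fun k => a * g k + b * h k) =
    a * cycle_mean n g + b * cycle_mean n h.
Proof.
elim: n g h => [//|n IHn] g h; rewrite !cycle_meanS.
by rewrite (IHn (fun k => g k.+1) (fun k => h k.+1)) IHn; ring.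
Qed.

Lemma le_cycle_mean n g h :
  (forall k, g k <= h k) -> cycle_mean n g <= cycle_mean n h.
Proof.
elim: n g h => [|n IHn] g h gh; first exact: gh.
rewrite !cycle_meanS.
rewrite ler_pM2r ?invr_gt0//; apply: lerD; first exact: IHn.
by apply: ler_wpM2l => //; exact: IHn.
Qed.

Lemma eq_cycle_mean n g h : g =1 h -> cycle_mean n g = cycle_mean n h.
Proof.
by move=> gh; apply/le_anti/andP; split; apply: le_cycle_mean => k; rewrite gh.
Qed.

Lemma cycle_mean_cst n (a : R) : cycle_mean n (fun=> a) = a.
Proof.
elim: n => [//|n IHn]; rewrite cycle_meanS IHn.
by rewrite -{1}[a]mul1r -mulrDl -natr1 addrC mulrC mulKf// natr1.
Qed.

(** Absorbing the last Bernoulli variable into the test function leaves a single mean over the first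
    [n] variables, ready for induction. *)
Lemma cycle_mean_comp_succ n g :
  cycle_mean n.+1 g =
    cycle_mean n (fun k => (2 * n).+1%:R^-1 * g k.+1
                           + (1 - (2 * n).+1%:R^-1) * g k).
Proof.
rewrite cycle_mean_lin cycle_meanS.
have -> : (2 * n)%:R = (2 * n).+1%:R - 1 :> R by rewrite -natr1 addrK.
by field.
Qed.

(** The product is the number of permutations, as the constant test function 1 shows. *)
Lemma even_cycle_sumE n g :
  even_cycle_sum n g = (\prod_(k < n) (2 * k).+1%:R ^+ 2) * cycle_mean n g.
Proof.
elim: n g => [|n IHn] g; first by rewrite big_ord0 mul1r.
rewrite even_cycle_sumS !IHn -mulr_natl -[_ *+ (2 * n)]mulr_natl.
rewrite cycle_meanS big_ord_recr /=.
have : (2 * n).+1%:R != 0 :> R by [].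
by move: (2 * n).+1%:R (2 * n)%:R => q m q0; field.
Qed.

Lemma mean_EvenPerms n g :
  (\sum_(s in EvenPerms n) g (ncycles s)) / #|EvenPerms n|%:R = cycle_mean n g.
Proof.
have cardE : #|EvenPerms n|%:R = \prod_(k < n) (2 * k).+1%:R ^+ 2 :> R.
  have := even_cycle_sumE n (fun=> 1); rewrite cycle_mean_cst mulr1 => <-.
  by rewrite -(sum_EvenPerms n (fun=> 1)) sumr_const.
rewrite sum_EvenPerms even_cycle_sumE cardE mulrC mulKf//.
by apply/prodf_neq0 => k _; rewrite expf_neq0.
Qed.

Lemma meanC_cycle_mean n : meanC R n = cycle_mean n (fun k => k%:R).
Proof. by rewrite -mean_EvenPerms. Qed.

Lemma cdf_std_C_cycle_mean n (x : R) :
  cdf_std_C R n x =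
  cycle_mean n (fun k => ((k%:R <= meanC R n + x * Num.sqrt (varC R n))%R : bool)%:R).
Proof.
rewrite -mean_EvenPerms /cdf_std_C; congr (_ / _).
rewrite -sum1_card natr_sum.
rewrite (eq_bigl (fun s : 'S_(2 * n) => (s \in EvenPerms n) &&
  ((ncycles s)%:R <= meanC R n + x * Num.sqrt (varC R n)))); last first.
  by move=> s; rewrite !inE.
by rewrite big_mkcondr; apply: eq_bigr => s _; case: ifP.
Qed.

Lemma meanCE n : meanC R n = \sum_(k < n) (2 * k).+1%:R^-1.
Proof.
rewrite meanC_cycle_mean; elim: n => [|n IHn]; first by rewrite big_ord0.
rewrite big_ord_recr /= -IHn cycle_mean_comp_succ.
rewrite (@eq_cycle_mean _ _ (fun k => 1 * k%:R + (2 * n).+1%:R^-1 * 1)).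
  by rewrite cycle_mean_lin cycle_mean_cst; ring.
by move=> k; rewrite -[k.+1%:R]natr1; ring.
Qed.

Lemma meanCS n : meanC R n.+1 = meanC R n + (2 * n).+1%:R^-1.
Proof. by rewrite !meanCE big_ord_recr. Qed.

Lemma varCE n : varC R n =
  \sum_(k < n) ((2 * k).+1%:R^-1 * (1 - (2 * k).+1%:R^-1)).
Proof.
(* The centre [c] must be free: a success of the last variable turns it into [c - 1]. *)
suff momE c : cycle_mean n (fun k => (k%:R - c) ^+ 2) =
    \sum_(k < n) ((2 * k).+1%:R^-1 * (1 - (2 * k).+1%:R^-1))
      + (meanC R n - c) ^+ 2.
  rewrite /varC (mean_EvenPerms n (fun k => (k%:R - meanC R n) ^+ 2)).
  by rewrite momE subrr expr0n addr0.
elim: n c => [|n IHn] c.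
  by rewrite big_ord0 add0r meanCE big_ord0.
rewrite cycle_mean_comp_succ cycle_mean_lin.
rewrite (@eq_cycle_mean _ (fun k => (k.+1%:R - c) ^+ 2)
                          (fun k => (k%:R - (c - 1)) ^+ 2)); last first.
  by move=> k; rewrite -[k.+1%:R]natr1; congr (_ ^+ 2); ring.
by rewrite !IHn big_ord_recr /= meanCS; ring.
Qed.

Lemma varCS n : varC R n.+1 =
  varC R n + (2 * n).+1%:R^-1 * (1 - (2 * n).+1%:R^-1).
Proof. by rewrite !varCE big_ord_recr. Qed.

End cycle_mean_theory.

(** * The normal distribution function: limits, derivatives and Taylor bounds *)

Section std_normal.
Variable R : realType.

(** The identity as a random variable under the normal law, so that general limits of distribution
    functions apply to [std_normal_cdf]. *)
Definition real_id : measurableTypeR R -> R := idfun.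

HB.instance Definition _ :=
  @isMeasurableFun.Build _ _ _ _ real_id (@measurable_id _ _ setT).

Definition std_normal_pdf (t : R) : R := expR (- (t ^+ 2) / 2) / Num.sqrt (2 * pi).

Lemma std_normal_pdfE : std_normal_pdf = normal_pdf 0 1.
Proof.
apply/funext => t; rewrite normal_pdfE ?oner_neq0//.
rewrite /normal_peak /normal_fun /std_normal_pdf mulrC subr0.
by rewrite expr1n mul1r mulr_natl.
Qed.

Lemma std_normal_cdfE (x : R) :
  std_normal_cdf R x = fine (normal_prob (0 : R) 1 `]-oo, x]).
Proof. by rewrite /normal_prob -std_normal_pdfE. Qed.

Lemma std_normal_cdf_ge0 (x : R) : 0 <= std_normal_cdf R x.
Proof. by rewrite std_normal_cdfE fine_ge0. Qed.

Lemma std_normal_cdf_le1 (x : R) : std_normal_cdf R x <= 1.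
Proof.
rewrite std_normal_cdfE -[leRHS]/(fine (1%:E)); apply: fine_le => //.
  by apply: fin_num_measure.
by apply: probability_le1.
Qed.

Lemma std_normal_cdf_nondecreasing (x y : R) :
  x <= y -> std_normal_cdf R x <= std_normal_cdf R y.
Proof.
move=> xy; rewrite !std_normal_cdfE; apply: fine_le.
- exact: fin_num_measure.
- exact: fin_num_measure.
- by rewrite le_measure ?inE//; exact: subitvPr.
Qed.

Lemma std_normal_cdf_cvgy : std_normal_cdf R x @[x --> +oo] --> (1 : R).
Proof.
have := @cvg_cdfy1 _ _ _ (normal_prob (0 : R) 1) real_id.
move/fine_cvg; apply: cvg_trans; apply: near_eq_cvg; apply: nearW => x.
by rewrite std_normal_cdfE.
Qed.

Lemma std_normal_cdf_cvgNy : std_normal_cdf R x @[x --> -oo] --> (0 : R).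
Proof.
have := @cvg_cdfNy0 _ _ _ (normal_prob (0 : R) 1) real_id.
move/fine_cvg; apply: cvg_trans; apply: near_eq_cvg; apply: nearW => x.
by rewrite std_normal_cdfE.
Qed.

Lemma std_normal_cdf_tails (e : R) : 0 < e -> exists2 M : R, 0 < M &
  forall x, (M <= x -> 1 - e <= std_normal_cdf R x) /\
            (x <= - M -> std_normal_cdf R x <= e).
Proof.
move=> e0.
have /cvgrPdist_le/(_ e e0)[M1 [_ hM1]] := std_normal_cdf_cvgy.
have /cvgrPdist_le/(_ e e0)[M2 [_ hM2]] := std_normal_cdf_cvgNy.
exists (`|M1| + `|M2| + 1).
  by rewrite ltr_pwDr// addr_ge0.
have := ler_norm M1; have := ler_norm (- M2); rewrite normrN => h1 h2.
have := normr_ge0 M1; have := normr_ge0 M2 => h3 h4.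
move=> x; split => hx.
  have /hM1 /= : M1 < x by lra.
  by rewrite ler_norml => /andP[_]; lra.
have /hM2 /= : x < M2 by lra.
by rewrite sub0r normrN => /(le_trans (ler_norm _)).
Qed.

Lemma is_derive_std_normal_pdf (t : R) :
  is_derive t 1 std_normal_pdf (- t * std_normal_pdf t).
Proof.
apply: is_derive_eq; rewrite /std_normal_pdf /GRing.scale /=.
by field; rewrite gt_eqF// sqrtr_gt0 mulr_gt0 ?pi_gt0.
Qed.

Lemma is_derive_std_normal_cdf (x : R) :
  is_derive x 1 (std_normal_cdf R) (std_normal_pdf x).
Proof.
have int : lebesgue_measure.-integrable `]-oo, x + 1]
    (EFin \o std_normal_pdf : R -> \bar R).
  rewrite std_normal_pdfE.
  by apply: (integrableS _ _ (@subsetT _ _)) => //; exact: integrable_normal_pdf.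
have cont : {for x, continuous std_normal_pdf}.
  by rewrite std_normal_pdfE; exact: continuous_normal_pdf.
have xx1 : x < x + 1 by rewrite ltrDl.
have [dF F'] := @continuous_FTC1 R std_normal_pdf -oo%O x _ xx1 int (ltNyr x) cont.
apply: DeriveDef; first exact: dF.
by rewrite -derive1E.
Qed.

(** Since [expR (t^2/4) >= 1 + t^2/4], its square dominates [1 + t^2/2 + t^4/16], whose coefficients
    give the constants 1, 2 and 16; the normalization [sqrt (2 pi)] is at least 1. *)
Lemma std_normal_pdf_bounds (t : R) :
  [/\ 0 <= std_normal_pdf t, std_normal_pdf t <= 1,
      t ^+ 2 * std_normal_pdf t <= 2 & t ^+ 4 * std_normal_pdf t <= 16].
Proof.
have sq1 : 1 <= Num.sqrt (2 * pi : R).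
  by rewrite -{1}sqrtr1 ler_sqrt; have := pi_ge2 R; lra.
have sq0 : 0 < Num.sqrt (2 * pi : R) by apply: lt_le_trans sq1.
have E0 := expR_gt0 (t ^+ 2 / 4).
have pE : std_normal_pdf t = (expR (t ^+ 2 / 4) ^+ 2 * Num.sqrt (2 * pi))^-1.
  rewrite /std_normal_pdf mulNr expRN invfM; congr (_^-1 / _).
  by rewrite [RHS]expr2 -expRD; congr expR; lra.
have D0 : 0 < expR (t ^+ 2 / 4) ^+ 2 * Num.sqrt (2 * pi) by rewrite mulr_gt0// exprn_gt0.
have le_bound y C : 0 <= C -> y <= C * expR (t ^+ 2 / 4) ^+ 2 -> y * std_normal_pdf t <= C.
  move=> C0 yC; rewrite pE ler_pdivrMr// mulrA; apply: le_trans yC _.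
  by rewrite ler_peMr// mulr_ge0// sqr_ge0.
have E1 := expR_ge1Dx (t ^+ 2 / 4).
have t0 := sqr_ge0 t.
have E2 : (1 + t ^+ 2 / 4) ^+ 2 <= expR (t ^+ 2 / 4) ^+ 2.
  by rewrite ler_sqr// nnegrE; lra.
have t4 : t ^+ 4 = t ^+ 2 * t ^+ 2 by rewrite -exprD.
have t40 : 0 <= t ^+ 4 by rewrite t4 mulr_ge0.
have sE : (1 + t ^+ 2 / 4) ^+ 2 = 1 + t ^+ 2 / 2 + t ^+ 4 / 16 by rewrite t4; field.
rewrite sE in E2.
split.
- by rewrite pE invr_ge0 ltW.
- by rewrite -[leLHS]mul1r; apply: le_bound => //; lra.
- by apply: le_bound => //; lra.
- by apply: le_bound => //; lra.
Qed.

(** Covers both orders of [a] and [b], since a centered Bernoulli step may go either way. *)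
Lemma mean_value (f f' : R -> R) (a b : R) :
  (forall x : R, is_derive x 1 f (f' x)) ->
  exists2 c, `|c - a| <= `|b - a| & f b - f a = f' c * (b - a).
Proof.
move=> df; have cf : continuous f.
  move=> y; apply/differentiable_continuous.
  by apply/derivable1_diffP; apply: ex_derive; exact: df.
have [ab|/ltW ba] := leP a b.
  have [|c] := @MVT_segment R f f' a b ab (fun y _ => df y).
    exact: continuous_subspaceT.
  rewrite in_itv /= => /andP[ac cb] fE; exists c => //.
  by rewrite !ger0_norm ?subr_ge0// lerD2r.
have [|c] := @MVT_segment R f f' b a ba (fun y _ => df y).
  exact: continuous_subspaceT.
rewrite in_itv /= => /andP[bc ca] fE; exists c.
  by rewrite !ler0_norm ?subr_le0// lerN2 lerD2r.
by rewrite -opprB fE -mulrN opprB.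
Qed.

Lemma taylor_order1 (f f' f'' : R -> R) (C a b : R) :
  (forall x : R, is_derive x 1 f (f' x)) -> (forall x : R, is_derive x 1 f' (f'' x)) ->
  (forall x, `|f'' x| <= C) ->
  `|f b - f a - f' a * (b - a)| <= C * `|b - a| ^+ 2.
Proof.
move=> df df' f''C.
have [c ca fE] := mean_value a b df; have [c' _ f'E] := mean_value a c df'.
rewrite fE -mulrBl f'E !normrM -mulrA expr2 ler_pM ?mulr_ge0//.
by rewrite ler_wpM2r.
Qed.

Lemma taylor_order2 (f f' f'' f3 : R -> R) (C a b : R) :
  (forall x : R, is_derive x 1 f (f' x)) -> (forall x : R, is_derive x 1 f' (f'' x)) ->
  (forall x : R, is_derive x 1 f'' (f3 x)) -> (forall x, `|f3 x| <= C) ->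
  `|f b - f a - f' a * (b - a) - f'' a / 2 * (b - a) ^+ 2|
    <= C * `|b - a| ^+ 3.
Proof.
move=> df df' df'' f3C.
(* Up to a constant, [f] minus its second-order Taylor polynomial at [a]; the derivative is the
   first-order remainder of [f']. *)
pose g x := f x - f' a * x - f'' a / 2 * (x - a) ^+ 2.
have dg (x : R) : is_derive x 1 g (f' x - f' a - f'' a * (x - a)).
  have dfx := df x.
  rewrite /g; apply: is_derive_eq; rewrite /GRing.scale /=.
  by field.
have [c ca gE] := mean_value a b dg.
have -> : f b - f a - f' a * (b - a) - f'' a / 2 * (b - a) ^+ 2 = g b - g a.
  by rewrite /g; ring.
have C0 : 0 <= C by apply: le_trans (f3C 0).
rewrite gE normrM exprSr mulrA ler_wpM2r//.
apply: le_trans (taylor_order1 _ _ df' df'' f3C) _.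
by rewrite ler_wpM2l// lerXn2r// nnegrE.
Qed.

Lemma std_normal_cdf_lipschitz (a b : R) :
  `|std_normal_cdf R b - std_normal_cdf R a| <= `|b - a|.
Proof.
have [c _ ->] := mean_value a b is_derive_std_normal_cdf.
have [p0 p1 _ _] := std_normal_pdf_bounds c.
by rewrite normrM ler_piMl// ger0_norm.
Qed.

Lemma std_normal_cdf_taylor (a b : R) :
  `|std_normal_cdf R b - std_normal_cdf R a - std_normal_pdf a * (b - a)
    + a * std_normal_pdf a / 2 * (b - a) ^+ 2| <= 3 * `|b - a| ^+ 3.
Proof.
have -> : a * std_normal_pdf a / 2 = - (- a * std_normal_pdf a / 2).
  by rewrite !mulNr opprK.
rewrite [X in _ + X]mulNr.
apply: (@taylor_order2 (std_normal_cdf R) std_normal_pdf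
  (fun x => - x * std_normal_pdf x)
  (fun x => (x ^+ 2 - 1) * std_normal_pdf x) 3 a b).
- exact: is_derive_std_normal_cdf.
- exact: is_derive_std_normal_pdf.
- move=> x; have dp := is_derive_std_normal_pdf x.
  apply: is_derive_eq; rewrite /GRing.scale /=; ring.
(* The constant 3 adds the bound 2 for [x^2] times the density and 1 for the density. *)
- move=> x; have [p0 p1 p2 _] := std_normal_pdf_bounds x.
  have := mulr_ge0 (sqr_ge0 x) p0.
  by rewrite mulrBl mul1r ler_norml => ?; apply/andP; split; lra.
Qed.

(** From [2c <= c^2 + 1] and [2c^3 <= c^4 + c^2] with [c = |b|]: the constants are [(2 + 1) / 2] and
    [(16 + 2) / 2]. *)
Lemma mul_std_normal_pdf_bounds (b : R) :
  `|b| * std_normal_pdf b <= 3 / 2 /\ `|b| ^+ 3 * std_normal_pdf b <= 9.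
Proof.
have [p0 p1 p2 p4] := std_normal_pdf_bounds b.
rewrite -(real_normK (num_real b)) in p2.
have b4 : b ^+ 4 = `|b| ^+ 4 by rewrite -[in RHS]normrX ger0_norm// exprn_even_ge0.
rewrite b4 in p4.
move: (`|b|) (std_normal_pdf b) (normr_ge0 b) p0 p1 p2 p4 => c p c0 p0 p1 p2 p4.
have q : 0 <= (c - 1) ^+ 2 * p by rewrite mulr_ge0// sqr_ge0.
have q' : 0 <= c ^+ 2 * (c - 1) ^+ 2 * p by rewrite mulr_ge0// mulr_ge0 ?sqr_ge0.
have qE : (c - 1) ^+ 2 * p = c ^+ 2 * p - 2 * (c * p) + p by ring.
have qE' : c ^+ 2 * (c - 1) ^+ 2 * p = c ^+ 4 * p - 2 * (c ^+ 3 * p) + c ^+ 2 * p.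
  by ring.
by split; lra.
Qed.

(* Together with std_normal_cdf_taylor this expresses that
   (v, x) |-> Phi (x / sqrt v) solves the heat equation. *)
Lemma std_normal_cdf_dilate (a w : R) :
  `|std_normal_cdf R (a * expR (- w / 2)) - std_normal_cdf R a
    + a * std_normal_pdf a / 2 * w| <= 3 * w ^+ 2.
Proof.
(* Here [w] is the logarithm of a ratio of variances; [b' = - b / 2] keeps all derivatives explicit
   in [b]. *)
pose b (w : R) := a * expR (- w / 2).
have db (u : R) : is_derive u 1 b (- b u / 2).
  by apply: is_derive_eq; rewrite /b /GRing.scale /=; by field.
pose k w := std_normal_cdf R (b w).
pose k' w := - b w * std_normal_pdf (b w) / 2.
pose k'' w := (b w - b w ^+ 3) * std_normal_pdf (b w) / 4.
have b0 : b 0 = a by rewrite /b oppr0 mul0r expR0 mulr1.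
have dk (u : R) : is_derive u 1 k (k' u).
  have := @is_derive1_comp R (std_normal_cdf R) b u _ _
    (is_derive_std_normal_cdf (b u)) (db u).
  by move=> /is_derive_eq; apply; rewrite /k'; ring.
have dpb (u : R) : is_derive u 1 (std_normal_pdf \o b)
    (- b u * std_normal_pdf (b u) * (- b u / 2)).
  exact: is_derive1_comp (is_derive_std_normal_pdf (b u)) (db u).
have dk' (u : R) : is_derive u 1 k' (k'' u).
  have dbu := db u; have dpbu := dpb u.
  have -> : k' = (fun w => - b w * (std_normal_pdf \o b) w / 2) by [].
  by apply: is_derive_eq; rewrite /k'' /GRing.scale /=; by field.
(* The constant comes from [(3/2 + 9) / 4 <= 3]. *)
have k''C u : `|k'' u| <= 3.
  rewrite /k'' normrM [`|_ * _|]normrM (ger0_norm (_ : 0 <= 4^-1))//.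
  have [p0 _ _ _] := std_normal_pdf_bounds (b u).
  rewrite (ger0_norm p0) ler_pdivrMr//.
  have [h1 h2] := mul_std_normal_pdf_bounds (b u).
  apply: le_trans (ler_wpM2r p0 (ler_normB _ _)) _.
  by rewrite normrX mulrDl; lra.
have := @taylor_order1 k k' k'' 3 0 w dk dk' k''C.
rewrite subr0 real_normK ?num_real// /k /k' b0 /b.
suff -> : - a * std_normal_pdf a / 2 * w = - (a * std_normal_pdf a / 2 * w).
  by rewrite opprK.
by rewrite !mulNr.
Qed.

End std_normal.

(** * Harmonic numbers, the Euler constant and the asymptotic mean *)

Section harmonic.
Variable R : realType.

Definition harm (n : nat) : R := \sum_(k < n) k.+1%:R^-1.

Lemma harmS n : harm n.+1 = harm n + n.+1%:R^-1.
Proof. by rewrite /harm big_ord_recr. Qed.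

(** Both bounds are [ln (1 + x) <= x], at [x = - 1/(n+1)] and at [x = 1/n]. *)
Lemma ln_succ_bounds n : (0 < n)%N ->
  n.+1%:R^-1 <= ln (n.+1%:R : R) - ln n%:R <= n%:R^-1.
Proof.
move=> n0; have n0' : (0 : R) < n%:R by rewrite ltr0n.
have n1' : (0 : R) < n.+1%:R by rewrite ltr0n.
apply/andP; split.
  rewrite -lerN2 opprB -ln_div ?posrE//.
  have -> : n%:R / n.+1%:R = 1 + - n.+1%:R^-1 :> R.
    rewrite -natr1; field.
    by rewrite natr1.
  apply: le_ln1Dx; rewrite ltrN2 invf_lt1// ltr1n.
  by rewrite ltnS.
rewrite -ln_div ?posrE//.
have -> : n.+1%:R / n%:R = 1 + n%:R^-1 :> R.
  by rewrite -natr1; field; rewrite gt_eqF.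
by apply: le_ln1Dx; rewrite (lt_trans (ltrN10 R))// invr_gt0.
Qed.

Lemma ln_succ_le_harm n : ln (n.+1%:R : R) <= harm n.
Proof.
elim: n => [|n IHn]; first by rewrite ln1 /harm big_ord0.
have /andP[_] := @ln_succ_bounds n.+1 isT.
by rewrite harmS; move: n.+1%:R^-1 => x; lra.
Qed.

(** From [n = 1] on, [H_n - ln n] decreases and [H_n - ln n - 1/n] increases; they enclose the
    limit. *)
Lemma harm_euler_gamma n : (0 < n)%N ->
  euler_gamma R + ln n%:R <= harm n <= euler_gamma R + ln n%:R + n%:R^-1.
Proof.
pose u (n : nat) : R := harm n - ln n%:R.
have uni m : u m.+2 <= u m.+1.
  have /andP[+ _] := @ln_succ_bounds m.+1 isT.
  by rewrite /u harmS; move: m.+2%:R^-1 => x; lra.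
have und m : u m.+1 - m.+1%:R^-1 <= u m.+2 - m.+2%:R^-1.
  have /andP[_] := @ln_succ_bounds m.+1 isT.
  rewrite /u [harm m.+2]harmS; move: m.+1%:R^-1 m.+2%:R^-1 => x y; lra.
have niu : nonincreasing_seq (fun m => u m.+1) by apply/nonincreasing_seqP.
have ndu : nondecreasing_seq (fun m => u m.+1 - m.+1%:R^-1).
  by apply/nondecreasing_seqP.
have lbu m k : u m.+1 - m.+1%:R^-1 <= u k.+1.
  have [mk|/ltnW km] := leqP m k.
    by apply: le_trans (ndu _ _ mk) _; rewrite lerBlDr lerDl invr_ge0.
  by apply: le_trans (niu _ _ km); rewrite lerBlDr lerDl invr_ge0.
have cu : cvgn (fun m => u m.+1).
  apply: nonincreasing_is_cvgn => //; exists (u 1%N - 1%:R^-1) => _ [k _ <-].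
  exact: lbu.
have -> : euler_gamma R = limn (fun m => u m.+1).
  have /cvg_ex[l ul] := cu.
  rewrite (cvg_lim _ ul)//; apply: cvg_lim => //.
  by rewrite -(cvg_shiftS u).
case: n => // n _; apply/andP; split.
  by have := nonincreasing_cvgn_ge niu cu n; rewrite /u lerBrDr.
suff : u n.+1 - n.+1%:R^-1 <= limn (fun m => u m.+1) by rewrite /u; move: n.+1%:R^-1 => x; lra.
by apply: limr_ge => //; apply: nearW => k; exact: lbu.
Qed.

Lemma meanC_harm n : meanC R n = harm (2 * n) - harm n / 2.
Proof.
elim: n => [|n IHn]; first by rewrite meanCE /harm muln0 !big_ord0 mul0r subr0.
rewrite meanCS IHn mulnS !harmS.
have -> : (2 * n).+2%:R = 2 * n.+1%:R :> R by rewrite -natrM mulnS.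
by rewrite invfM; move: (2 * n).+1%:R^-1 n.+1%:R^-1 => x y; lra.
Qed.

Lemma meanC_asymptotic n : (0 < n)%N ->
  `| meanC R n - (ln (n%:R : R) / 2 + (euler_gamma R / 2 + ln (2 : R))) |
    <= n%:R^-1.
Proof.
move=> n0; have n0' : (0 : R) < n%:R by rewrite ltr0n.
have /andP[h1 h2] := harm_euler_gamma n0.
have : (0 < 2 * n)%N by rewrite muln_gt0.
move=> /harm_euler_gamma; rewrite natrM lnM ?posrE// invfM => /andP[h3 h4].
have := n0'; rewrite -invr_gt0 => n0''.
rewrite meanC_harm ler_norml; move: n%:R^-1 h2 h4 n0'' => x h2 h4 n0''.
by apply/andP; split; lra.
Qed.

(** Termwise, [1/(2k+1)] is at least half of [1/(k+1)]. This later makes the variance tend to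
    infinity. *)
Lemma meanC_ge n : ln (n.+1%:R : R) / 2 <= meanC R n.
Proof.
have /le_trans -> // : ln (n.+1%:R : R) / 2 <= harm n / 2.
  by rewrite ler_pM2r ?invr_gt0//; exact: ln_succ_le_harm.
rewrite meanCE /harm mulr_suml; apply: ler_sum => k _.
by rewrite -invfM lef_pV2 ?posrE// -natrM ler_nat; lia.
Qed.

End harmonic.

(** * Inverse odd squares and the asymptotic variance *)

Section odd_inverse_squares.
Variable R : realType.

Lemma sin_le_id (x : R) : 0 <= x -> sin x <= x.
Proof.
move=> x0; have [|c _] := @MVT_segment R sin cos 0 x x0 (fun=> _).
  by apply: continuous_subspaceT; exact: continuous_sin.
by rewrite sin0 !subr0 => ->; rewrite ler_piMl// cos_le1.
Qed.

(** This is [x <= tan x] without the division; [sin y - y cos y] has derivative [y sin y >= 0]. *)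
Lemma mul_cos_le_sin (x : R) : 0 <= x <= pi / 2 -> x * cos x <= sin x.
Proof.
move=> /andP[x0 xpi].
pose f (y : R) := sin y - y * cos y.
have df (y : R) : is_derive y 1 f (y * sin y).
  apply: is_derive_eq; rewrite /GRing.scale /=; ring.
have [|c] := @MVT_segment R f (fun y => y * sin y) 0 x x0 (fun y _ => df y).
  apply: continuous_subspaceT => y; apply/differentiable_continuous.
  by apply/derivable1_diffP; apply: ex_derive; exact: df.
rewrite in_itv /= /f => /andP[c0 cx]; rewrite sin0 mul0r !subr0 => fE.
rewrite -subr_ge0 fE mulr_ge0// mulr_ge0// sin_ge0_pi// c0 /=.
have := pi_ge0 R; lra.
Qed.

Lemma sum_csc_sqr (m : nat) :
  \sum_(k < 2 ^ m) (sin (k.*2.+1%:R * (pi / (2 ^ m.+2)%:R)) ^- 2 : R)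
    = 2 * 4 ^+ m.
Proof.
elim: m => [|m IHm].
  rewrite big_ord1 expr0 mulr1 mul1r.
  have := cos_mulr2n (pi / 4 : R); have := cos2Dsin2 (pi / 4 : R).
  have -> : (pi / 4 : R) *+ 2 = pi / 2 by rewrite mulr2n; lra.
  rewrite cos_pihalf (_ : (2 ^ 2)%:R = 4)//.
  move=> h1 h2; have -> : sin (pi / 4 : R) ^+ 2 = 2^-1 by lra.
  by rewrite invrK.
set h : R := pi / (2 ^ m.+3)%:R.
have hE : pi / (2 ^ m.+2)%:R = 2 * h.
  by rewrite /h (expnS 2 m.+2) natrM invfM; field.
rewrite hE in IHm.
(* The second half of the nodes, reversed, consists of the complements to [pi / 2] of the first
   half, so its terms become squared secants. *)
rewrite expnS mul2n -addnn big_split_ord /= [X in _ + X](reindex_inj rev_ord_inj) /=.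
rewrite -big_split /= exprS mulrCA -IHm mulr_sumr; apply: eq_bigr => k _.
have klt := ltn_ord k.
have -> : (2 ^ m + (2 ^ m - k.+1)).*2.+1%:R * h = pi / 2 - k.*2.+1%:R * h.
  have -> : (2 ^ m + (2 ^ m - k.+1)).*2.+1 = (2 ^ m.+2 - k.*2.+1)%N.
    by rewrite !expnS; lia.
  rewrite natrB; last by rewrite !expnS; lia.
  rewrite mulrBl; congr (_ - _).
  by rewrite /h (expnS 2 m.+2) natrM invfM; field; rewrite pnatr_eq0 expn_eq0.
rewrite sinB sin_pihalf cos_pihalf mul1r mul0r subr0.
set x := k.*2.+1%:R * h.
have -> : k.*2.+1%:R * (2 * h) = x *+ 2 by rewrite mulrCA mulr_natl.
rewrite sin_mulr2n.
have h0 : 0 < h by rewrite divr_gt0 ?pi_gt0// ltr0n expn_gt0.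
have x0 : 0 < x by rewrite mulr_gt0.
have xpi : x < pi / 2.
  rewrite /x /h mulrA ltr_pdivrMr ?ltr0n ?expn_gt0//.
  rewrite mulrC mulrAC -mulrA ltr_pM2l ?pi_gt0//.
  rewrite ltr_pdivlMr// -natrM ltr_nat !expnS; lia.
have s0 : sin x != 0 by rewrite gt_eqF// sin_gt0_pihalf// x0.
have c0 : cos x != 0 by rewrite gt_eqF// cos_gt0_pihalf// xpi andbT; lra.
have := cos2Dsin2 x.
rewrite -mulr_natl; move: (sin x) (cos x) s0 c0 => s c s0 c0 sc.
have -> : s ^- 2 + c ^- 2 = (c ^+ 2 + s ^+ 2) / (s ^+ 2 * c ^+ 2).
  by field; rewrite s0 c0.
by rewrite sc; field; rewrite s0 c0.
Qed.

Definition odd_inv_sqr_sum (n : nat) : R := \sum_(k < n) k.*2.+1%:R ^- 2.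

Lemma odd_inv_sqr_sum_le m n :
  (m <= n)%N -> odd_inv_sqr_sum m <= odd_inv_sqr_sum n.
Proof.
move=> mn; rewrite /odd_inv_sqr_sum -!(big_mkord xpredT (fun k => k.*2.+1%:R ^- 2)).
by rewrite [leRHS](big_cat_nat _ mn)//= lerDl sumr_ge0// => k _; rewrite invr_ge0 exprn_ge0.
Qed.

Lemma pi_le4 : (pi : R) <= 4.
Proof. have [/andP[_]] := pihalf_02_cos_pihalf R; lra. Qed.

(* The squeeze cot^2 x <= 1/x^2 <= csc^2 x at the nodes of sum_csc_sqr. *)
Lemma odd_inv_sqr_sum_pow2 m :
  pi ^+ 2 / 8 - (2 ^+ m)^-1 <= odd_inv_sqr_sum (2 ^ m) <= pi ^+ 2 / 8.
Proof.
set h : R := pi / (2 ^ m.+2)%:R.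
have h0 : 0 < h by rewrite divr_gt0 ?pi_gt0// ltr0n expn_gt0.
have Sh : odd_inv_sqr_sum (2 ^ m) = h ^+ 2 * \sum_(k < 2 ^ m) (k.*2.+1%:R * h) ^- 2.
  rewrite mulr_sumr; apply: eq_bigr => k _.
  rewrite [(_ * h) ^+ 2]exprMn [(_ * h ^+ 2)^-1]invfM.
  by rewrite mulrCA mulfV ?mulr1// expf_neq0// gt_eqF.
have hE : h ^+ 2 * (2 * 4 ^+ m) = pi ^+ 2 / 8.
  rewrite /h natrX exprMn exprVn -exprM mulnC mulnS mulnS exprD exprD exprM.
  rewrite (_ : 2 ^+ 2 = 4 :> R); last by rewrite -natrX.
  have : (4 : R) ^+ m != 0 by rewrite expf_neq0.
  by move: (4 ^+ m) => q q0; field.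
have node k : (k < 2 ^ m)%N -> 0 < k.*2.+1%:R * h <= pi / 2.
  move=> klt; rewrite mulr_gt0//=.
  rewrite /h mulrA ler_pdivrMr ?ltr0n ?expn_gt0//.
  rewrite mulrC mulrAC -mulrA ler_pM2l ?pi_gt0//.
  rewrite ler_pdivlMr// -natrM ler_nat !expnS; lia.
have sinp (x : R) : 0 < x <= pi / 2 -> 0 < sin x.
  move=> /andP[x0 xpi]; apply: sin_gt0_pi; rewrite x0 /=; lra.
rewrite Sh -hE; apply/andP; split; last first.
  rewrite ler_pM2l ?exprn_gt0// -sum_csc_sqr; apply: ler_sum => k _.
  have := node k (ltn_ord k); rewrite -/h; set x := _ * h => xpi.
  have x0 : 0 < x by case/andP: xpi.
  rewrite lef_pV2 ?posrE ?exprn_gt0 ?sinp//.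
  by rewrite ler_sqr ?nnegrE ?sin_le_id// ltW// sinp.
(* The error is [h^2] per node; [pi <= 4] bounds its total by [2^-m]. *)
have -> : (2 ^+ m)^-1 = h ^+ 2 * 2 ^+ m * (16 / pi ^+ 2).
  rewrite /h natrX !exprS !invfM.
  have : (2 : R) ^+ m != 0 by rewrite expf_neq0.
  have : (pi : R) != 0 by rewrite gt_eqF// pi_gt0.
  by move: (2 ^+ m) (pi : R) => q p p0 q0; field; rewrite p0 q0.
have le1 : h ^+ 2 * 2 ^+ m <= h ^+ 2 * 2 ^+ m * (16 / pi ^+ 2).
  apply: ler_peMr; first by rewrite mulr_ge0 ?exprn_ge0// ltW.
  rewrite ler_pdivlMr ?exprn_gt0 ?pi_gt0// mul1r.
  rewrite (_ : 16 = 4 ^+ 2); last by ring.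
  by rewrite ler_sqr ?nnegrE ?pi_le4// pi_ge0.
apply: le_trans (lerB (lexx _) le1) _.
rewrite -mulrBr ler_pM2l ?exprn_gt0// -sum_csc_sqr.
(* Spreading [2^m] as one unit per node reduces the bound to [csc^2 x <= 1/x^2 + 1], that is
   [cot^2 x <= 1/x^2]. *)
rewrite lerBlDr -natrX -[X in _ + X%:R](card_ord (2 ^ m)) -sumr_const -big_split /=.
apply: ler_sum => k _; have := node k (ltn_ord k); rewrite -/h; set x := _ * h.
move=> xpi; have x0 : 0 < x by case/andP: xpi.
have s0 := sinp _ xpi.
rewrite -[leLHS]div1r -[X in X / _](cos2Dsin2 x) mulrDl mulfV ?expf_neq0 ?gt_eqF// lerD2r.
rewrite ler_pdivrMr ?exprn_gt0// mulrC ler_pdivlMr ?exprn_gt0// -exprMn mulrC.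
have xc : x * cos x <= sin x by apply: mul_cos_le_sin; case/andP: xpi => /ltW ->.
have c0 : 0 <= cos x by apply: cos_ge0_pihalf; move: xpi; have := pi_ge0 R; lra.
by rewrite ler_sqr// nnegrE; [apply: mulr_ge0; rewrite // ltW|rewrite ltW].
Qed.

(** Monotonicity reduces to powers of two. The largest power [2^m <= n] satisfies [1/2^m <= 2/n],
    whence the constant 2. *)
Lemma odd_inv_sqr_sum_asymptotic n : (0 < n)%N ->
  pi ^+ 2 / 8 - 2 / n%:R <= odd_inv_sqr_sum n <= pi ^+ 2 / 8.
Proof.
move=> n0; apply/andP; split; last first.
  have n2 : (n <= 2 ^ n)%N by rewrite ltnW// ltn_expl.
  apply: le_trans (odd_inv_sqr_sum_le n2) _.
  by case/andP: (odd_inv_sqr_sum_pow2 n).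
have /andP[le1 lt2] := trunc_log_bounds (isT : 1 < 2)%N n0.
apply: le_trans (odd_inv_sqr_sum_le le1).
case/andP: (odd_inv_sqr_sum_pow2 (trunc_log 2 n)) => + _; apply: le_trans.
rewrite lerB// -natrX ler_pdivlMr ?ltr0n// mulrC ler_pdivrMr ?ltr0n ?expn_gt0//.
by rewrite -natrM ler_nat -expnS ltnW.
Qed.

Lemma varC_odd_inv_sqr_sum n : varC R n = meanC R n - odd_inv_sqr_sum n.
Proof.
rewrite varCE meanCE /odd_inv_sqr_sum -sumrB; apply: eq_bigr => k _.
by rewrite mulrBr mulr1 -invfM -expr2 mul2n.
Qed.

(** The constant adds 1 from the mean and 2 from the inverse odd squares. *)
Lemma varC_asymptotic n : (0 < n)%N ->
  `| varC R n - (ln (n%:R : R) / 2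
                 + (euler_gamma R / 2 + ln (2 : R) - pi ^+ 2 / 8)) |
    <= 3 / n%:R.
Proof.
move=> n0; have := meanC_asymptotic R n0.
have := odd_inv_sqr_sum_asymptotic n0.
have : (0 : R) < n%:R^-1 by rewrite invr_gt0 ltr0n.
rewrite varC_odd_inv_sqr_sum !ler_norml.
move: n%:R^-1 => x x0 /andP[h1 h2] /andP[h3 h4].
by apply/andP; split; lra.
Qed.

End odd_inverse_squares.

(** * Lindeberg replacement and convergence in distribution *)

Section central_limit.
Variable R : realType.
Local Notation Phi := (std_normal_cdf R).

(** The cost of a replacement at scale [t], per unit of [p]: [3 / t^3] bounds the Taylor remainders,
    [4 / t^4] the second-order errors in the variance. *)
Definition swap_error (t : R) : R := 3 / t ^+ 3 + 4 / t ^+ 4.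

Lemma swap_error_ge0 t : 0 < t -> 0 <= swap_error t.
Proof. by move=> t0; rewrite addr_ge0// divr_ge0// exprn_ge0// ltW. Qed.

Lemma le_swap_error t u : 0 < t -> t <= u -> swap_error u <= swap_error t.
Proof.
move=> t0 tu; have u0 := lt_le_trans t0 tu.
by apply: lerD; rewrite ler_pM2l// lef_pV2 ?posrE ?exprn_gt0// lerXn2r// nnegrE ltW.
Qed.

Lemma ln1D_bounds (r : R) : 0 <= r -> 0 <= r - ln (1 + r) <= r ^+ 2.
Proof.
move=> r0; have r1 : 0 < 1 + r by lra.
apply/andP; split; first by rewrite subr_ge0 le_ln1Dx//; lra.
have : ln ((1 + r)^-1) <= - (r / (1 + r)).
  rewrite [X in ln X](_ : _ = 1 + - (r / (1 + r))); last first.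
    by field; rewrite gt_eqF.
  by apply: le_ln1Dx; rewrite ltrN2 ltr_pdivrMr//; lra.
rewrite lnV ?posrE// lerN2 => h.
have : r - r ^+ 2 <= r / (1 + r).
  have r3 : 0 <= r ^+ 2 * r by rewrite mulr_ge0// sqr_ge0.
  by rewrite ler_pdivlMr//; lra.
by move: h; set y := r / _; lra.
Qed.

(* Replaces a centered Bernoulli step of variance p (1 - p) by a Gaussian one of
   the same variance. *)
Lemma std_normal_cdf_swap (t u x p : R) : 0 < t -> 0 < u -> 0 <= p <= 1 ->
  u ^+ 2 = t ^+ 2 + p * (1 - p) ->
  `|p * Phi ((x - (1 - p)) / t) + (1 - p) * Phi ((x + p) / t) - Phi (x / u)|
    <= p * swap_error t.
Proof.
move=> t0 u0 /andP[p0 p1] utp; have q0 : 0 <= 1 - p by lra.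
(* [r] is the relative increase of variance and [w = ln (u^2 / t^2)], so that [x / u] is a dilate of
   [a]. *)
pose a := x / t; pose r := p * (1 - p) / t ^+ 2; pose w := ln (1 + r).
have r0 : 0 <= r by rewrite /r divr_ge0// ?mulr_ge0// ltW// exprn_gt0.
have /andP[wr rw] := ln1D_bounds r0.
have w0 : 0 <= w by rewrite ln_ge0//; lra.
have uE : x / u = a * expR (- w / 2).
  have -> : u = t * expR (w / 2).
    apply/eqP; rewrite -(eqrXn2 (n := 2))//; try by rewrite ltW// mulr_gt0// expR_gt0.
    rewrite exprMn [expR _ ^+ 2]expr2 -expRD -splitr lnK; last by rewrite posrE; lra.
    by rewrite utp /r; apply/eqP; field; rewrite gt_eqF.
  by rewrite mulNr expRN /a invfM mulrA.
have [f0 _ _ _] := std_normal_pdf_bounds a.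
have [q1 _] := mul_std_normal_pdf_bounds a.
have D := std_normal_cdf_dilate a w; rewrite -uE in D.
have T1 := std_normal_cdf_taylor a ((x - (1 - p)) / t).
have T2 := std_normal_cdf_taylor a ((x + p) / t).
have d1 : (x - (1 - p)) / t - a = - ((1 - p) / t) by rewrite /a; ring.
have d2 : (x + p) / t - a = p / t by rewrite /a; ring.
have n1 : `|(1 - p) / t| = (1 - p) / t by rewrite ger0_norm// divr_ge0// ltW.
have n2 : `|p / t| = p / t by rewrite ger0_norm// divr_ge0// ltW.
rewrite d1 normrN n1 in T1; rewrite d2 n2 in T2.
have qn : `|a * std_normal_pdf a / 2| <= 3 / 4.
  rewrite normrM normrM (ger0_norm f0) (ger0_norm (_ : 0 <= 2^-1))//.
  by move: q1; move: (_ * _) => y; lra.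
move: (Phi _) (Phi _) (Phi _) (Phi _) (std_normal_pdf a) qn D T1 T2
  => F1 F2 F3 Fa f {f0 q1}.
move: (a * f / 2) => q qn D T1 T2.
set E1 := (X in `|X|) in T1; set E2 := (X in `|X|) in T2.
set E3 := (X in `|X|) in D.
(* First-order terms cancel because the step is centered; the second-order term is [q * r], against
   [q * w] from the dilation. *)
have -> : p * F2 + (1 - p) * F1 - Fa = p * E1 + (1 - p) * E2 - E3 + q * (w - r).
  by rewrite /E1 /E2 /E3 /r; field; rewrite gt_eqF.
have ti0 : 0 <= t^-1 by rewrite invr_ge0 ltW.
have rE : r ^+ 2 <= p * t^-1 ^+ 4.
  have -> : r ^+ 2 = p ^+ 2 * (1 - p) ^+ 2 * t^-1 ^+ 4.
    by rewrite /r; field; rewrite gt_eqF.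
  rewrite ler_wpM2r ?exprn_ge0// expr2 -mulrA ler_piMr//.
  by rewrite mulr_ile1 ?exprn_ge0 ?exprn_ile1//; lra.
have w2 : w ^+ 2 <= r ^+ 2 by rewrite ler_sqr ?nnegrE// -subr_ge0.
have qw : `|q * (w - r)| <= 3 / 4 * r ^+ 2.
  by rewrite normrM distrC (ger0_norm wr) ler_pM.
have pE1 : `|p * E1| <= p * (3 * ((1 - p) / t) ^+ 3).
  by rewrite normrM (ger0_norm p0) ler_wpM2l.
have pE2 : `|(1 - p) * E2| <= (1 - p) * (3 * (p / t) ^+ 3).
  by rewrite normrM (ger0_norm q0) ler_wpM2l.
have cubes : p * (3 * ((1 - p) / t) ^+ 3) + (1 - p) * (3 * (p / t) ^+ 3)
    <= p * (3 * t^-1 ^+ 3).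
  have -> : p * (3 * ((1 - p) / t) ^+ 3) + (1 - p) * (3 * (p / t) ^+ 3) =
      p * (((1 - p) * ((1 - p) ^+ 2 + p ^+ 2)) * (3 * t^-1 ^+ 3)).
    by field; rewrite gt_eqF.
  rewrite ler_wpM2l// ler_piMl ?mulr_ge0 ?exprn_ge0//.
  have pq0 := mulr_ge0 p0 q0.
  rewrite mulr_ile1//; [|lra|lra].
  by rewrite addr_ge0 ?exprn_ge0.
have -> : p * swap_error t = p * (3 * t^-1 ^+ 3) + 4 * (p * t^-1 ^+ 4).
  by rewrite /swap_error; field; rewrite gt_eqF.
apply: le_trans (ler_normD _ _) _.
apply: le_trans (lerD (ler_normB _ _) qw) _.
apply: le_trans (lerD (lerD (ler_normD _ _) D) (lexx _)) _.
move: (p * t^-1 ^+ 4) (p * (3 * t^-1 ^+ 3)) rE cubes => X4 X3 rE cubes.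
have r20 := sqr_ge0 r; move: (r ^+ 2) (w ^+ 2) w2 r20 rE => r2 w2 w2r r20 rE.
have := pE1; have := pE2.
move: cubes; move: (p * (3 * _)) ((1 - p) * (3 * _)) => C1 C2; lra.
Qed.

Lemma cycle_mean_dist n (g h : nat -> R) (e : R) :
  (forall k, `|g k - h k| <= e) -> `|cycle_mean n g - cycle_mean n h| <= e.
Proof.
have le_dist f f' : (forall k, `|f k - f' k| <= e) ->
    cycle_mean n f <= cycle_mean n f' + e.
  move=> ff'; rewrite -[X in _ + X](cycle_mean_cst n).
  rewrite -[X in X + _]mul1r -[X in _ + X]mul1r -cycle_mean_lin.
  apply: le_cycle_mean => k; rewrite !mul1r addrC -lerBlDr.
  exact: le_trans (ler_norm _) (ff' k).
move=> gh; have le1 := le_dist g h gh.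
have le2 : cycle_mean n h <= cycle_mean n g + e.
  by apply: le_dist => k; rewrite distrC.
by rewrite ler_norml; apply/andP; split; lra.
Qed.

(** Each replacement enlarges the scale and [swap_error] decreases with it, so [swap_error t] serves
    for all steps; the parameters [p] add up to the mean. *)
Lemma cycle_mean_swap n (t x : R) : 0 < t ->
  `|cycle_mean n (fun k => Phi ((x - (k%:R - meanC R n)) / t))
    - Phi (x / Num.sqrt (t ^+ 2 + varC R n))| <= meanC R n * swap_error t.
Proof.
elim: n t => [|n IHn] t t0.
  rewrite /cycle_mean /= meanCE varCE !big_ord0 subrr subr0 addr0.
  by rewrite sqrtr_sqr (gtr0_norm t0) subrr normr0 mul0r.
pose p : R := (2 * n).+1%:R^-1.
have p01 : 0 <= p <= 1 by rewrite /p invr_ge0 ler0n /= invf_le1// ler1n.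
have d0 : 0 <= p * (1 - p) by case/andP: p01 => ? ?; rewrite mulr_ge0// subr_ge0.
pose u := Num.sqrt (t ^+ 2 + p * (1 - p)).
have tu2 : 0 < t ^+ 2 + p * (1 - p) by rewrite ltr_pwDl// exprn_gt0.
have u2 : u ^+ 2 = t ^+ 2 + p * (1 - p) by rewrite sqr_sqrtr// ltW.
have u0 : 0 < u by rewrite sqrtr_gt0.
have tu : t <= u by rewrite -(@ler_sqr R) ?nnegrE ?(ltW t0) ?(ltW u0)// u2 lerDl.
have IH := IHn u u0; rewrite u2 -addrA [p * _ + _]addrC -varCS in IH.
rewrite cycle_mean_comp_succ -/p.
pose mid := cycle_mean n (fun k => Phi ((x - (k%:R - meanC R n)) / u)).
apply: le_trans (ler_distD mid _ _) _.
rewrite meanCS -/p mulrDl addrC; apply: lerD; last first.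
  apply: cycle_mean_dist => k.
  have := std_normal_cdf_swap (x - (k%:R - meanC R n)) t0 u0 p01 u2.
  rewrite (_ : x - (k.+1%:R - _) = x - (k%:R - meanC R n) - (1 - p)); last first.
    by rewrite -natr1; ring.
  by rewrite (_ : x - (k%:R - (_ + _)) = x - (k%:R - meanC R n) + p)//; ring.
apply: le_trans IH _; rewrite ler_wpM2l ?le_swap_error//.
by rewrite meanCE sumr_ge0// => k _; rewrite invr_ge0.
Qed.

Lemma cdf_std_C_ge0 n (z : R) : 0 <= cdf_std_C R n z.
Proof. by rewrite /cdf_std_C divr_ge0. Qed.

Lemma cdf_std_C_le1 n (z : R) : cdf_std_C R n z <= 1.
Proof.
rewrite cdf_std_C_cycle_mean -[leRHS](cycle_mean_cst n).
by apply: le_cycle_mean => k; rewrite lern1 leq_b1.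
Qed.

(** Shifting the smoothed indicator by [d] standard deviations makes it at least [Phi (d / t)] on
    the event, or at most [Phi (- (d / t))] off it. *)
Lemma cdf_std_C_sandwich n (z d t : R) : 0 < varC R n -> 0 < t ->
  let e := meanC R n * swap_error (t * Num.sqrt (varC R n)) in
  cdf_std_C R n z * Phi (d / t) <= Phi ((z + d) / Num.sqrt (1 + t ^+ 2)) + e /\
  Phi ((z - d) / Num.sqrt (1 + t ^+ 2)) - e - Phi (- (d / t)) <= cdf_std_C R n z.
Proof.
move=> v0 t0; set s := Num.sqrt (varC R n) => /=.
have s0 : 0 < s by rewrite sqrtr_gt0.
have ts0 : 0 < t * s by rewrite mulr_gt0.
have s2 : s ^+ 2 = varC R n by rewrite sqr_sqrtr// ltW.
have swap y := cycle_mean_swap n (y * s) ts0.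
have sqrtE y : y * s / Num.sqrt ((t * s) ^+ 2 + varC R n) = y / Num.sqrt (1 + t ^+ 2).
  rewrite -s2 exprMn -[X in _ + X]mul1r -mulrDl [t ^+ 2 + 1]addrC.
  rewrite sqrtrM; last by rewrite addr_ge0// sqr_ge0.
  by rewrite sqrtr_sqr (gtr0_norm s0) invfM mulrACA divff ?mulr1// gt_eqF.
have mono := @std_normal_cdf_nondecreasing R.
rewrite cdf_std_C_cycle_mean -/s; split.
  have := swap (z + d); rewrite sqrtE ler_norml lerBlDr [_ + Phi _]addrC.
  move=> /andP[_]; apply: le_trans; rewrite mulrC.
  rewrite -[leLHS]addr0 -[X in _ + X](mul0r (cycle_mean n (fun=> 0))) -cycle_mean_lin.
  apply: le_cycle_mean => k; rewrite mul0r addr0.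
  case: (lerP k%:R (meanC R n + z * s)) => [kz|_] /=; last by rewrite mulr0 std_normal_cdf_ge0.
  rewrite mulr1; apply: mono; rewrite ler_pdivlMr// mulrA divfK ?gt_eqF//; lra.
have := swap (z - d); rewrite sqrtE ler_norml => /andP[+ _].
rewrite lerBrDl => h.
suff : cycle_mean n (fun k => Phi (((z - d) * s - (k%:R - meanC R n)) / (t * s))) <=
    1 * cycle_mean n (fun k => ((k%:R <= meanC R n + z * s)%R : bool)%:R)
      + Phi (- (d / t)) * cycle_mean n (fun=> 1).
  by rewrite cycle_mean_cst mulr1 mul1r; lra.
rewrite -cycle_mean_lin; apply: le_cycle_mean => k; rewrite mul1r mulr1.
case: (lerP k%:R (meanC R n + z * s)) => [_|kz] /=.
  by rewrite mulr1n (le_trans (std_normal_cdf_le1 _))// lerDl std_normal_cdf_ge0.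
rewrite add0r; apply: mono.
rewrite ler_pdivrMr// mulNr mulrA divfK ?gt_eqF//; lra.
Qed.

Lemma odd_inv_sqr_sum_le2 n : odd_inv_sqr_sum R n <= 2.
Proof.
case: n => [|n]; first by rewrite /odd_inv_sqr_sum big_ord0.
have /andP[_ le8] := @odd_inv_sqr_sum_asymptotic R n.+1 isT.
apply: le_trans le8 _; rewrite ler_pdivrMr//.
have -> : 2 * 8 = 4 ^+ 2 :> R by ring.
by rewrite ler_sqr ?nnegrE ?pi_ge0 ?pi_le4.
Qed.

Lemma varC_large (A : R) : exists N, forall n, (N <= n)%N -> A <= varC R n.
Proof.
(* The mean is at least [ln (n+1) / 2], and the inverse odd squares subtract at most 2. *)
exists (Num.truncn (expR (2 * (A + 2)))) => n Nn.
have ltn : expR (2 * (A + 2)) <= n.+1%:R.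
  by apply: le_trans (ltW (truncnS_gt _)) _; rewrite ler_nat.
have leln : 2 * (A + 2) <= ln n.+1%:R.
  by rewrite -ler_expR lnK// posrE.
have := meanC_ge R n; have := odd_inv_sqr_sum_le2 n.
rewrite varC_odd_inv_sqr_sum.
by move: (ln _) leln => l leln; lra.
Qed.

Lemma meanC_swap_error_small (e t : R) : 0 < e -> 0 < t ->
  exists N, forall n, (N <= n)%N ->
    0 < varC R n /\ meanC R n * swap_error (t * Num.sqrt (varC R n)) <= e.
Proof.
move=> e0 t0; pose B := 2 * swap_error t / e.
(* The summand 2 gives [s >= 1] and mean at most [2 s^2]; with
   [swap_error (t s) <= swap_error t / s^3] the product is at most [2 swap_error t / s], hence at
   most [e] once [s >= B]. *)
have [N NP] := varC_large (2 + B ^+ 2); exists N => n /NP vB.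
have B0 : 0 <= B by rewrite divr_ge0 ?mulr_ge0 ?swap_error_ge0// ltW.
have B2 := sqr_ge0 B; have v0 : 0 < varC R n by lra.
split => //; set s := Num.sqrt _.
have s0 : 0 < s by rewrite sqrtr_gt0.
have s2 : s ^+ 2 = varC R n by rewrite sqr_sqrtr// ltW.
have s1 : 1 <= s by rewrite -sqrtr1 ler_sqrt//; lra.
have Bs : B <= s by rewrite -(@ler_sqr R) ?nnegrE ?(ltW s0)// s2; lra.
have m2 : meanC R n <= 2 * s ^+ 2.
  have := odd_inv_sqr_sum_le2 n; have := varC_odd_inv_sqr_sum R n; rewrite s2; lra.
have ets : swap_error (t * s) <= swap_error t / s ^+ 3.
  have tn : t != 0 by rewrite gt_eqF.
  have sn : s != 0 by rewrite gt_eqF.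
  have -> : swap_error (t * s) = 3 / t ^+ 3 / s ^+ 3 + 4 / t ^+ 4 / s ^+ 4.
    by rewrite /swap_error; field; rewrite tn sn.
  rewrite /swap_error [leRHS]mulrDl; apply: lerD => //.
  have t4 : 0 <= 4 / t ^+ 4 by rewrite divr_ge0// exprn_ge0// ltW.
  by rewrite ler_wpM2l// lef_pV2 ?posrE ?exprn_gt0// ler_weXn2l.
apply: le_trans (ler_pM _ _ m2 ets) _.
- by rewrite meanCE sumr_ge0// => k _; rewrite invr_ge0.
- by rewrite swap_error_ge0// mulr_gt0.
have -> : 2 * s ^+ 2 * (swap_error t / s ^+ 3) = 2 * swap_error t / s.
  by field; rewrite gt_eqF.
by rewrite ler_pdivrMr// [e * s]mulrC -ler_pdivrMr.
Qed.

(** The divisor lies between 1 and [1 + t], so its inverse differs from 1 by at most [t]. *)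
Lemma shrink_dist (z d t : R) : 0 < t ->
  `|(z + d) / Num.sqrt (1 + t ^+ 2) - z| <= `|d| + `|z| * t.
Proof.
move=> t0; set h := Num.sqrt _.
have t2 := sqr_ge0 t.
have h1 : 1 <= h by rewrite -sqrtr1 ler_sqrt; lra.
have h0 : 0 < h by lra.
have ht : h <= 1 + t.
  rewrite -(@ler_sqr R) ?nnegrE ?(ltW h0)//; last by lra.
  by rewrite sqr_sqrtr; lra.
have g1 : 0 <= 1 - h^-1 by rewrite subr_ge0 invf_le1.
have gt : 1 - h^-1 <= t.
  by rewrite lerBlDr -lerBlDl -[leRHS]mul1r ler_pdivlMr//; nra.
have -> : (z + d) / h - z = d / h - z * (1 - h^-1) by ring.
apply: le_trans (ler_normB _ _) _; apply: lerD.
  by rewrite normrM ler_piMr// gtr0_norm ?invr_gt0// invf_le1.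
by rewrite normrM (ger0_norm g1) ler_wpM2l.
Qed.

Lemma cdf_std_C_cvg (z : R) : (fun n => cdf_std_C R n z) @ \oo --> Phi z.
Proof.
apply/cvgrPdist_le => e e0.
(* Four errors of size [d]: the shift, the rescaling of [z], the replacement and the tail. *)
pose d := e / 4; have d0 : 0 < d by rewrite divr_gt0.
have [M M0 MP] := std_normal_cdf_tails d0.
(* The first bound makes [|z| * t <= d], with [+ 1] guarding against [z = 0]; the second makes
   [d / t >= M]. *)
pose t := Num.min (d / (`|z| + 1)) (d / M).
have z1 : 0 < `|z| + 1 by rewrite ltr_wpDl.
have t0 : 0 < t by rewrite lt_min !divr_gt0.
have tz : `|z| * t <= d.
  apply: le_trans (_ : (`|z| + 1) * t <= _); first by rewrite ler_wpM2r ?lerDl ?ltW.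
  by rewrite mulrC -ler_pdivlMr// ge_min lexx.
have tM : M <= d / t by rewrite ler_pdivlMr// mulrC -ler_pdivlMr// ge_min lexx orbT.
have [N NP] := meanC_swap_error_small d0 t0.
exists N => // n /= /NP[v0 err].
have [le1 le2] := cdf_std_C_sandwich z d v0 t0.
move: le1 le2 err; set E := meanC R n * _ => le1 le2 err.
have [tail1 _] := MP (d / t); have {}tail1 := tail1 tM.
have [_ tail2] := MP (- (d / t)).
have {}tail2 : Phi (- (d / t)) <= d by apply: tail2; rewrite lerN2.
have := shrink_dist z d t0; have := shrink_dist z (- d) t0.
rewrite normrN (gtr0_norm d0) => s1 s2.
have /(le_trans (std_normal_cdf_lipschitz z _)) := s1.
have /(le_trans (std_normal_cdf_lipschitz z _)) := s2.
have P0 := cdf_std_C_ge0 n z; have P1 := cdf_std_C_le1 n z.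
have PT : cdf_std_C R n z <= cdf_std_C R n z * Phi (d / t) + d.
  rewrite -lerBlDl -[X in X - _]mulr1 -mulrBr.
  apply: le_trans (_ : 1 * d <= _); last by rewrite mul1r.
  by apply: ler_pM => //; have := std_normal_cdf_le1 (d / t); lra.
move: le1 le2 PT; rewrite !ler_norml => le1 le2 PT /andP[_ h1] /andP[h2 _].
have de : e = 4 * d by rewrite /d; field.
by apply/andP; split; lra.
Qed.

End central_limit.

Theorem theorem3p8 (R : realType) :
  (forall x : R, (fun n : nat => cdf_std_C R n x) @ \oo --> std_normal_cdf R x) /\
  (exists K : R, exists N : nat, forall n : nat, (N <= n)%N ->
     `| meanC R n - (ln (n%:R : R) / 2 + (euler_gamma R / 2 + ln (2 : R))) |
       <= K / n%:R) /\
  (exists K : R, exists N : nat, forall n : nat, (N <= n)%N ->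
     `| varC R n - (ln (n%:R : R) / 2
                    + (euler_gamma R / 2 + ln (2 : R) - pi ^+ 2 / 8)) |
       <= K / n%:R).
Proof.
split; first exact: cdf_std_C_cvg.
split.
  exists 1, 1%N => n n0; rewrite div1r; exact: meanC_asymptotic.
by exists 3, 1%N => n n0; exact: varC_asymptotic.
Qed.
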